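(* Let $G\rightrightarrows M$ be a Lie groupoid equipped with a 2-metric $\eta^{(2)}$, with induced metrics $\eta^{(1)}$ on $G$ and $\eta^{(0)}$ on $M$, and let $F:G\to\mathbb{R}$ be a Lie groupoid morphism covering a basic function $f:M\to\mathbb{R}$. Then the gradient $\nabla F=(\nabla(s^*f),\nabla f)$, where $\nabla(s^*f)$ is the gradient of $s^*f$ with respect to $\eta^{(1)}$ and $\nabla f$ is the gradient of $f$ with respect to $\eta^{(0)}$, is a multiplicative vector field on $G$.
   Context: A Lie groupoid $G\rightrightarrows M$ has source and target $s,t:G\to M$ (surjective submersions), composition $m:G^{(2)}\to G$ on $G^{(2)}=\{(g,h):s(g)=t(h)\}$ and projections $\pi_1,\pi_2:G^{(2)}\to G$. A basic function is $f\in C^\infty(M)$ with $s^*f=t^*f$; Lie groupoid morphisms from $G$ to the unit groupoid $\mathbb{R}\rightrightarrows\mathbb{R}$ are exactly $F=s^*f=t^*f$ with $f$ basic. A Riemannian metric on the total space of a surjective submersion $\pi:E\to B$ is transverse to $\pi$ if for $e_1,e_2$ in one fibre the map $d\pi(e_1)^*\circ(d\pi(e_2)^* )^{-1}:\ker(d\pi(e_2))^\circ\to\ker(d\pi(e_1))^\circ$ between annihilators is an isometry for the dual metric; then there is a unique push-forward metric $\pi_*\eta^E$ on $B$ making $\pi$ a Riemannian submersion. A 2-metric is a Riemannian metric $\eta^{(2)}$ on $G^{(2)}$ invariant under the $S_3$-action permuting the vertices of the commutative triangles determined by composable pairs, and transverse to $m$. It induces $\eta^{(1)}=m_*\eta^{(2)}=(\pi_1)_*\eta^{(2)}=(\pi_2)_*\eta^{(2)}$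 on $G$ and $\eta^{(0)}=s_*\eta^{(1)}=t_*\eta^{(1)}$ on $M$, so that $\pi_1,m,\pi_2,s,t$ are Riemannian submersions and the inversion is an isometry. A multiplicative vector field on $G\rightrightarrows M$ is a pair $(X^1,X^0)$ of vector fields on $G$ and $M$ which is a Lie groupoid morphism from $G\rightrightarrows M$ to the tangent groupoid $TG\rightrightarrows TM$ (whose structural maps are the differentials of those of $G$). *)

(* Defs.v *)
From HB Require Import structures.
From mathcomp Require Import all_boot all_order all_algebra all_fingroup.
From mathcomp Require Import all_classical all_reals all_analysis.

Set Implicit Arguments.
Unset Strict Implicit.
Unset Printing Implicit Defensive.

Import Order.TTheory GRing.Theory Num.Theory.
Import numFieldNormedType.Exports.

Local Open Scope classical_set_scope.
Local Open Scope ring_scope.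

(** * Smooth maps between normed spaces *)

Fixpoint ndifferentiable_on (R : realType) (V W : normedModType R) (k : nat)
    (U : set V) (f : V -> W) : Prop :=
  if k is k'.+1 then
    (forall x, U x -> differentiable f x) /\
    (forall v, ndifferentiable_on k' U ('D_v f))
  else True.

(** [C^oo] on [U] in the sense of infinite Frechet differentiability; it is only
    used for open sets [U] of finite-dimensional spaces. *)
Definition smooth_on (R : realType) (V W : normedModType R)
    (U : set V) (f : V -> W) : Prop :=
  forall k, ndifferentiable_on k U f.

(** * Manifolds *)

(** The atlas is indexed by [cindex]; any point [p] comes with a preferred chart
    [chart_at p] around it, in which tangent vectors at [p] are written. *)
Record manifold (R : realType) := Manifold {
  carrier :> topologicalType;
  mdim : nat;
  cindex : Type;
  cdom : cindex -> set carrier;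
  ccod : cindex -> set 'rV[R]_mdim;
  chart : cindex -> carrier -> 'rV[R]_mdim;
  param : cindex -> 'rV[R]_mdim -> carrier;
  chart_at : carrier -> cindex;
  mhausdorff : hausdorff_space carrier;
  msecond_countable : @second_countable carrier;
  cdom_open : forall i, open (cdom i);
  ccod_open : forall i, open (ccod i);
  chartK : forall i p, cdom i p -> ccod i (chart i p) /\ param i (chart i p) = p;
  paramK : forall i x, ccod i x -> cdom i (param i x) /\ chart i (param i x) = x;
  chart_continuous : forall i p, cdom i p -> {for p, continuous (chart i)};
  param_continuous : forall i x, ccod i x -> {for x, continuous (param i)};
  transition_smooth : forall i j,
      smooth_on [set x | ccod i x /\ cdom j (param i x)] (chart j \o param i);
  chart_atP : forall p, cdom (chart_at p) p
}.

Section Manifolds.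
Variable R : realType.
Implicit Types X Y Z : manifold R.

Definition smooth_map X Y (phi : X -> Y) : Prop :=
  continuous phi /\
  forall (i : cindex X) (j : cindex Y),
    smooth_on [set x | ccod i x /\ cdom j (phi (param i x))]
              (chart j \o phi \o param i).

Definition smooth_fun X (f : X -> R) : Prop :=
  forall i : cindex X, smooth_on (ccod i) (f \o param i).

(** Every tangent space [T_p X] is modelled on R^n, through the chart
    [chart_at p]; in particular [(p, v) : TX] stands for the vector [v] at [p]. *)
Definition tangent X := 'rV[R]_(mdim X).

Definition tangent_bundle X : Type := (X * tangent X)%type.

Definition dmap X Y (phi : X -> Y) (p : X) : tangent X -> tangent Y :=
  'd (chart (chart_at (phi p)) \o phi \o param (chart_at p))
     (chart (chart_at p) p).

Definition tmap X Y (phi : X -> Y) (pv : tangent_bundle X) : tangent_bundle Y :=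
  (phi pv.1, dmap phi pv.1 pv.2).

Definition dfun X (f : X -> R) (p : X) : tangent X -> R :=
  'd (f \o param (chart_at p)) (chart (chart_at p) p).

(** The tangent vector at [param i x] with components [v] in the chart [i]. *)
Definition of_chart X (i : cindex X) (x : 'rV[R]_(mdim X)) (v : 'rV[R]_(mdim X)) :
    tangent X :=
  'd (chart (chart_at (param i x)) \o param i) x v.

(** The components in the chart [i] of the tangent vector [v] at [p]. *)
Definition to_chart X (i : cindex X) (p : X) (v : tangent X) : 'rV[R]_(mdim X) :=
  'd (chart i \o param (chart_at p)) (chart (chart_at p) p) v.

Definition vector_field X (V : X -> tangent X) : Prop :=
  forall i : cindex X,
    smooth_on (ccod i) (fun x => to_chart i (param i x) (V (param i x))).

Definition surjective_submersion X Y (phi : X -> Y) : Prop :=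
  [/\ smooth_map phi,
      forall y, exists x, phi x = y
    & forall p w, exists v, dmap phi p v = w].

(** * Riemannian metrics *)

Definition metric_tensor X := X -> tangent X -> tangent X -> R.

Definition riemannian_metric X (eta : metric_tensor X) : Prop :=
  [/\ forall p (a : R) u v w,
        eta p (a *: u + v) w = a * eta p u w + eta p v w,
      forall p v w, eta p v w = eta p w v,
      forall p v, v != 0 -> 0 < eta p v v
    & forall (i : cindex X) v w,
        smooth_on (ccod i)
          (fun x => eta (param i x) (of_chart i x v) (of_chart i x w) : R)].

(** The vector representing the covector [alpha] at [p]. *)
Definition sharp X (eta : metric_tensor X) (p : X) (alpha : tangent X -> R) :
    tangent X :=
  xget 0 [set v | forall w, eta p v w = alpha w].

Definition dual_metric X (eta : metric_tensor X) (p : X)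
    (alpha beta : tangent X -> R) : R :=
  eta p (sharp eta p alpha) (sharp eta p beta).

Definition grad X (eta : metric_tensor X) (f : X -> R) (p : X) : tangent X :=
  sharp eta p (dfun f p).

(** The codifferential [dphi(e)^*]. *)
Definition codiff X Y (phi : X -> Y) (e : X) (beta : tangent Y -> R) :
    tangent X -> R :=
  beta \o dmap phi e.

(** For a submersion, [codiff phi e] is a bijection from the covectors at
    [phi e] to the annihilator of [ker (dmap phi e)]. *)
Definition transverse X Y (phi : X -> Y) (eta : metric_tensor X) : Prop :=
  forall e1 e2, phi e1 = phi e2 ->
  forall beta gamma : {linear tangent Y -> R^o},
    dual_metric eta e1 (codiff phi e1 beta) (codiff phi e1 gamma) =
    dual_metric eta e2 (codiff phi e2 beta) (codiff phi e2 gamma).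

Definition horizontal X Y (phi : X -> Y) (eta : metric_tensor X) (e : X) :
    set (tangent X) :=
  [set v | forall u, dmap phi e u = 0 -> eta e v u = 0].

Definition riemannian_submersion X Y (phi : X -> Y)
    (etaX : metric_tensor X) (etaY : metric_tensor Y) : Prop :=
  surjective_submersion phi /\
  forall e v w, horizontal phi etaX e v -> horizontal phi etaX e w ->
    etaY (phi e) (dmap phi e v) (dmap phi e w) = etaX e v w.

(** [etaY] is the push-forward metric [phi_* etaX]. *)
Definition pushforward_metric X Y (phi : X -> Y)
    (etaX : metric_tensor X) (etaY : metric_tensor Y) : Prop :=
  riemannian_metric etaY /\ riemannian_submersion phi etaX etaY.

Definition preserves_metric X (phi : X -> X) (eta : metric_tensor X) : Prop :=
  forall p v w, eta (phi p) (dmap phi p v) (dmap phi p w) = eta p v w.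

(** * Lie groupoids *)

(** The fibre product of [f] and [g] as an embedded submanifold of [X * Y]: its
    points are the pairs with [f x = g y], it is a pullback in the category of
    manifolds (which determines the smooth structure), and its tangent spaces
    are the fibre products of the tangent spaces. For submersions such a
    manifold always exists. *)
Record fibre_product X Y Z (f : X -> Z) (g : Y -> Z) := FibreProduct {
  fp_space :> manifold R;
  fp1 : fp_space -> X;
  fp2 : fp_space -> Y;
  fp_comm : forall p, f (fp1 p) = g (fp2 p);
  fp_pair : forall x y, f x = g y -> fp_space;
  fp1_pair : forall x y (e : f x = g y), fp1 (fp_pair e) = x;
  fp2_pair : forall x y (e : f x = g y), fp2 (fp_pair e) = y;
  fp_inj : forall p q, fp1 p = fp1 q -> fp2 p = fp2 q -> p = q;
  fp1_smooth : smooth_map fp1;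
  fp2_smooth : smooth_map fp2;
  fp_universal : forall (N : manifold R) (phi : N -> fp_space),
      smooth_map (fp1 \o phi) -> smooth_map (fp2 \o phi) -> smooth_map phi;
  fp_tangent : forall p v w, dmap f (fp1 p) v = dmap g (fp2 p) w ->
      exists! z, dmap fp1 p z = v /\ dmap fp2 p z = w
}.

(** [gpairs] is the manifold of pairs [(g, h)] with [gsrc g = gtgt h], and
    [gmul (g, h)] is the product [gh]. *)
Record lie_groupoid := LieGroupoid {
  gobj : manifold R;
  garr : manifold R;
  gsrc : garr -> gobj;
  gtgt : garr -> gobj;
  gpairs : fibre_product gsrc gtgt;
  gmul : gpairs -> garr;
  gunit : gobj -> garr;
  ginv : garr -> garr;
  gsrc_submersion : surjective_submersion gsrc;
  gtgt_submersion : surjective_submersion gtgt;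
  gmul_smooth : smooth_map gmul;
  gunit_smooth : smooth_map gunit;
  ginv_smooth : smooth_map ginv;
  gsrc_mul : forall p, gsrc (gmul p) = gsrc (fp2 p);
  gtgt_mul : forall p, gtgt (gmul p) = gtgt (fp1 p);
  gsrc_unit : forall x, gsrc (gunit x) = x;
  gtgt_unit : forall x, gtgt (gunit x) = x;
  gsrc_inv : forall g, gsrc (ginv g) = gtgt g;
  gtgt_inv : forall g, gtgt (ginv g) = gsrc g;
  gmulA : forall g h k
      (gh : gsrc g = gtgt h) (hk : gsrc h = gtgt k)
      (g_hk : gsrc g = gtgt (gmul (fp_pair gpairs hk)))
      (gh_k : gsrc (gmul (fp_pair gpairs gh)) = gtgt k),
      gmul (fp_pair gpairs g_hk) = gmul (fp_pair gpairs gh_k);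
  gmul1 : forall g (e : gsrc g = gtgt (gunit (gsrc g))),
      gmul (fp_pair gpairs e) = g;
  gmul1l : forall g (e : gsrc (gunit (gtgt g)) = gtgt g),
      gmul (fp_pair gpairs e) = g;
  gmulV : forall g (e : gsrc g = gtgt (ginv g)),
      gmul (fp_pair gpairs e) = gunit (gtgt g);
  gmulVl : forall g (e : gsrc (ginv g) = gtgt g),
      gmul (fp_pair gpairs e) = gunit (gsrc g)
}.

(** ** The action of [S_3] on composable pairs *)

(** A pair [(g, h)] determines the commutative triangle with vertices
    [0 = gtgt g], [1 = gsrc g = gtgt h] and [2 = gsrc h]; [edge p i j] is its
    arrow from the vertex [j] to the vertex [i]. *)
Definition vertex (G : lie_groupoid) (p : gpairs G) (i : 'I_3) : gobj G :=
  match val i with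
  | 0 => gtgt (fp1 p)
  | 1 => gsrc (fp1 p)
  | _ => gsrc (fp2 p)
  end.

Definition edge (G : lie_groupoid) (p : gpairs G) (i j : 'I_3) : garr G :=
  match val i, val j with
  | 0, 1 => fp1 p
  | 1, 2 => fp2 p
  | 0, 2 => gmul p
  | 1, 0 => ginv (fp1 p)
  | 2, 1 => ginv (fp2 p)
  | 2, 0 => ginv (gmul p)
  | _, _ => gunit (vertex p i)
  end%N.

Lemma gsrc_edge (G : lie_groupoid) (p : gpairs G) i j :
  gsrc (edge p i j) = vertex p j.
Proof.
case: i j => [[|[|[|//]]] ?] [[|[|[|//]]] ?]; rewrite /edge /vertex /= ?gsrc_unit
  ?gsrc_inv ?gsrc_mul ?gtgt_mul ?(fp_comm p) //.
Qed.

Lemma gtgt_edge (G : lie_groupoid) (p : gpairs G) i j :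
  gtgt (edge p i j) = vertex p i.
Proof.
case: i j => [[|[|[|//]]] ?] [[|[|[|//]]] ?]; rewrite /edge /vertex /= ?gtgt_unit
  ?gtgt_inv ?gsrc_mul ?gtgt_mul ?(fp_comm p) //.
Qed.

Lemma edge_composable (G : lie_groupoid) (p : gpairs G) i j k :
  gsrc (edge p i j) = gtgt (edge p j k).
Proof. by rewrite gsrc_edge gtgt_edge. Qed.

Definition triangle_act (G : lie_groupoid) (sigma : 'S_3) (p : gpairs G) :
    gpairs G :=
  fp_pair (gpairs G)
    (edge_composable p (sigma (inord 0)) (sigma (inord 1)) (sigma (inord 2))).

Definition two_metric (G : lie_groupoid) (eta2 : metric_tensor (gpairs G)) :
    Prop :=
  [/\ riemannian_metric eta2,
      forall sigma : 'S_3, preserves_metric (triangle_act sigma) eta2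
    & transverse (@gmul G) eta2].

(** By the [S_3]-invariance, [eta1] is then also the push-forward of [eta2] along
    both projections, and [eta0] that of [eta1] along [gtgt]. *)
Definition induced_metrics (G : lie_groupoid) (eta2 : metric_tensor (gpairs G))
    (eta1 : metric_tensor (garr G)) (eta0 : metric_tensor (gobj G)) : Prop :=
  pushforward_metric (@gmul G) eta2 eta1 /\
  pushforward_metric (@gsrc G) eta1 eta0.

(** ** Groupoid morphisms and multiplicative vector fields *)

(** The structural maps of a groupoid, without smooth structure; the composition
    is given by its graph, [gcomp g h k] meaning that [g] and [h] are composable
    with product [k]. *)
Record groupoid_data := GroupoidData {
  ob : Type;
  ar : Type;
  src : ar -> ob;
  tgt : ar -> ob;
  idm : ob -> ar;
  gcomp : ar -> ar -> ar -> Prop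
}.

Definition groupoid_morphism (A B : groupoid_data)
    (phi1 : ar A -> ar B) (phi0 : ob A -> ob B) : Prop :=
  [/\ forall g, src (phi1 g) = phi0 (src g),
      forall g, tgt (phi1 g) = phi0 (tgt g),
      forall x, phi1 (idm x) = idm (phi0 x)
    & forall g h k, gcomp g h k -> gcomp (phi1 g) (phi1 h) (phi1 k)].

Definition underlying_groupoid (G : lie_groupoid) : groupoid_data :=
  {| src := @gsrc G; tgt := @gtgt G; idm := @gunit G;
     gcomp := fun g h k => exists p : gpairs G,
       [/\ fp1 p = g, fp2 p = h & gmul p = k] |}.

Definition unit_groupoid (T : Type) : groupoid_data :=
  {| src := @id T; tgt := @id T; idm := @id T;
     gcomp := fun a b c => a = b /\ b = c |}.

(** The product of [v] and [w] in [TG] is the image under [Tm] of the vector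
    [z = (v, w)] tangent to [gpairs G], which is unique by [fp_tangent]. *)
Definition tangent_groupoid (G : lie_groupoid) : groupoid_data :=
  {| src := tmap (@gsrc G); tgt := tmap (@gtgt G); idm := tmap (@gunit G);
     gcomp := fun v w u => exists z : tangent_bundle (gpairs G),
       [/\ tmap (@fp1 _ _ _ _ _ (gpairs G)) z = v,
           tmap (@fp2 _ _ _ _ _ (gpairs G)) z = w & tmap (@gmul G) z = u] |}.

Definition basic_function (G : lie_groupoid) (f : gobj G -> R) : Prop :=
  smooth_fun f /\ f \o @gsrc G = f \o @gtgt G.

(** [F] is a Lie groupoid morphism to the unit groupoid of the real line,
    covering [f]. *)
Definition real_lie_morphism (G : lie_groupoid)
    (F : garr G -> R) (f : gobj G -> R) : Prop :=
  [/\ smooth_fun F, smooth_fun f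
    & @groupoid_morphism (underlying_groupoid G) (unit_groupoid R) F f].

(** Smoothness of a section as a map to the tangent bundle is its smoothness as
    a vector field. *)
Definition multiplicative_vector_field (G : lie_groupoid)
    (V1 : garr G -> tangent (garr G)) (V0 : gobj G -> tangent (gobj G)) : Prop :=
  [/\ vector_field V1, vector_field V0
    & @groupoid_morphism (underlying_groupoid G) (tangent_groupoid G)
        (fun g => (g, V1 g)) (fun x => (x, V0 x))].

End Manifolds.

(* Main.v *)
Require Import Defs.
From HB Require Import structures.
From mathcomp Require Import all_boot all_order all_algebra all_fingroup.
From mathcomp Require Import all_classical all_reals all_analysis.

Set Implicit Arguments.
Unset Strict Implicit.
Unset Printing Implicit Defensive.

Import Order.TTheory GRing.Theory Num.Theory.
Import numFieldNormedType.Exports.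

Local Open Scope classical_set_scope.
Local Open Scope ring_scope.

(** The proof rests on two naturality properties of gradients. Along a
    Riemannian submersion [phi] the gradient of a pulled back function
    [f \o phi] is horizontal and is mapped to the gradient of [f]
    ([grad_pushforward]); an isometry preserving [f] is a special case.

    Put [Z = grad eta2 (f \o gsrc \o gmul)]. As [f] is basic, it takes the same
    value at the three vertices of a triangle, so the function defining [Z] is
    invariant under the action of [S_3]. The product [gmul] is a Riemannian
    submersion, hence it maps [Z] to [V = grad eta1 (f \o gsrc)]. Both
    projections are [gmul] preceded by a transposition of two vertices: [fp1 = gmul \o swap12] and [fp2 = gmul \o swap01]. Since the
    transpositions are isometries fixing [Z], the projections map [Z] to [V] as
    well ([grad_gmul_isometry]). Thus [Z] at [(g, h)] is the tangent vector
    [(V g, V h)], and its image under the differential of [gmul] is [V (gh)]: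
    this is compatibility with products.

    The source map is a Riemannian submersion, so it maps [V] to [grad eta0 f].
    The target map does too: [gsrc \o fp1 = gtgt \o fp2], and the vector
    [Z] at a pair with second entry [h] projects to [V] on both sides. At a
    unit, [V] is idempotent in the tangent groupoid by compatibility with
    products, and an idempotent arrow of a groupoid is a unit
    ([idempotent_tangent_unit]).

    Smoothness of the gradients is Cramer's rule: in a chart the gradient is the
    row of partial derivatives times the inverse of the Gram matrix
    ([grad_vector_field]). This and the chain rule for maps between manifolds
    need the closure of smooth maps under algebraic operations and
    composition. *)

(** * Locality of the differential *)

Section LocalDiff.
Variables (R : realType) (V W : normedModType R).

Lemma is_diff_near0 (h : V -> W) (x : V) :
  (\forall y \near x, h y = 0) -> is_diff x h (0 : V -> W).
Proof.
move=> h0.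
have c0 : continuous (0 : V -> W) by move=> ?; exact: cvg_cst.
have hE : h \o shift x = cst (h x) + (0 : V -> W) +o_ 0 id.
  apply/eqaddoP => _/posnumP[e].
  have : \forall y \near (0 : V), h (y + x) = 0.
    by move: h0; rewrite (near_shift 0 x) subr0.
  apply: filterS => y /= hy.
  rewrite !fctE /= hy (nbhs_singleton h0) addr0 subrr normr0.
  by rewrite mulr_ge0.
have dE := @diff_unique _ _ _ h (\0 : {linear V -> W}) x c0 hE.
by split => //; apply/diff_locallyP; rewrite dE.
Qed.

(** Differentiability at a point only sees the germ of the function: the
    difference of two functions with the same germ has differential zero. *)
Lemma near_eq_is_diff (f g : V -> W) (x : V) :
  {near x, f =1 g} -> differentiable f x -> is_diff x g ('d f x).
Proof.
move=> fg df.
have -> : g = f + (g - f) by apply/funext => y; rewrite !fctE addrC subrK.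
have d0 : is_diff x (g - f) (0 : V -> W).
  by apply: is_diff_near0; apply: filterS fg => y fgy; rewrite !fctE fgy subrr.
have dfx := differentiableP df.
have [dfg dfgE] := is_diffD dfx d0.
by split=> //; rewrite dfgE; apply/funext => y; rewrite !fctE addr0.
Qed.

Lemma near_eq_differentiable (f g : V -> W) (x : V) :
  {near x, f =1 g} -> differentiable f x -> differentiable g x.
Proof. by move=> fg df; have [] := near_eq_is_diff fg df. Qed.

Lemma near_eq_diff (f g : V -> W) (x : V) :
  {near x, f =1 g} -> differentiable f x -> 'd g x = 'd f x :> (V -> W).
Proof. by move=> fg df; have [] := near_eq_is_diff fg df. Qed.

End LocalDiff.

(** * Calculus of infinitely differentiable maps *)

Section Smooth.
Variable R : realType.
Implicit Types V W : normedModType R.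

Lemma ndiff_sub V W k (U U' : set V) (f : V -> W) : U `<=` U' ->
  ndifferentiable_on k U' f -> ndifferentiable_on k U f.
Proof.
move=> UU'; elim: k f => [//|k IH] f /= [df Df].
by split=> [x /UU'|v]; [exact: df|exact: IH].
Qed.

(** [ndifferentiable_on] is a pointwise condition on the iterated derivatives,
    so neither [U] nor the sets [U'] have to be open. *)
Lemma ndiff_local V W k (U : set V) (f : V -> W) :
  (forall x, U x -> exists2 U', U' x & ndifferentiable_on k U' f) ->
  ndifferentiable_on k U f.
Proof.
elim: k f => [//|k IH] f loc /=; split=> [x Ux|v].
  by have [U' U'x [df _]] := loc x Ux; exact: df.
by apply: IH => x Ux; have [U' U'x [_ Df]] := loc x Ux;
  exists U' => //; exact: Df.
Qed.

(** Here openness of [U] is essential: it makes the directional derivatives of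
    [f] and [g] agree on [U], which keeps the induction going. *)
Lemma ndiff_congr V W k (U : set V) (f g : V -> W) : open U ->
  {in U, f =1 g} -> ndifferentiable_on k U f -> ndifferentiable_on k U g.
Proof.
move=> oU; elim: k f g => [//|k IH] f g fg /= [df Df].
have near_fg x : U x -> {near x, f =1 g}.
  move=> Ux; have : nbhs x U by apply: open_nbhs_nbhs.
  by apply: filterS => y Uy; apply: fg; exact/mem_set.
split=> [x Ux|v].
  exact: near_eq_differentiable (near_fg x Ux) (df x Ux).
apply: IH (Df v) => x /set_mem Ux.
exact: near_eq_derive (near_fg x Ux).
Qed.

Lemma ndiff_pred V W k (U : set V) (f : V -> W) :
  ndifferentiable_on k.+1 U f -> ndifferentiable_on k U f.
Proof.
elim: k f => [//|k IH] f [df Df]; split=> // v.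
exact: IH (Df v).
Qed.

Lemma ndiff_cst V W k (U : set V) (c : W) : ndifferentiable_on k U (cst c).
Proof.
elim: k c => [//|k IH] c /=; split=> [x _|v]; first exact: differentiable_cst.
have -> : 'D_v (cst c) = cst (0 : W) by apply/funext => x; exact: derive_cst.
exact: IH.
Qed.

Lemma ndiff_add V W k (U : set V) (f g : V -> W) : open U ->
  ndifferentiable_on k U f -> ndifferentiable_on k U g ->
  ndifferentiable_on k U (f + g).
Proof.
move=> oU; elim: k f g => [//|k IH] f g /= [df Df] [dg Dg].
split=> [x Ux|v]; first exact: differentiableD (df x Ux) (dg x Ux).
apply: (@ndiff_congr _ _ _ _ ('D_v f + 'D_v g)) (IH _ _ (Df v) (Dg v)) => //.
move=> x /set_mem Ux; rewrite deriveD //; apply: diff_derivable;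
  [exact: df|exact: dg].
Qed.

Lemma ndiff_sum V W k (U : set V) I (r : seq I) (P : pred I) (f : I -> V -> W) :
  open U -> (forall i, P i -> ndifferentiable_on k U (f i)) ->
  ndifferentiable_on k U (fun x => \sum_(i <- r | P i) f i x).
Proof.
move=> oU df.
have -> : (fun x => \sum_(i <- r | P i) f i x) = \sum_(i <- r | P i) f i.
  by apply/funext => x; rewrite fct_sumE.
elim/big_ind : _ => //; first exact: ndiff_cst.
by move=> ? ?; exact: ndiff_add.
Qed.

Lemma ndiff_scalel V W k (U : set V) (f : V -> R) (w : W) : open U ->
  ndifferentiable_on k U f -> ndifferentiable_on k U (fun x => f x *: w).
Proof.
move=> oU; elim: k f => [//|k IH] f /= [df Df].
split=> [x Ux|v]; first exact: differentiableZl (df x Ux).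
apply: (@ndiff_congr _ _ _ _ (fun x => 'D_v f x *: w)) (IH _ (Df v)) => //.
move=> x /set_mem Ux; have dfx := df x Ux.
by rewrite !deriveE ?diffZl //; exact: differentiableZl.
Qed.

Lemma ndiff_mul V k (U : set V) (f g : V -> R) : open U ->
  ndifferentiable_on k U f -> ndifferentiable_on k U g ->
  ndifferentiable_on k U (fun x => f x * g x).
Proof.
move=> oU; elim: k f g => [//|k IH] f g /= dkf dkg.
have [df Df] := dkf; have [dg Dg] := dkg.
split=> [x Ux|v]; first exact: differentiableM (df x Ux) (dg x Ux).
apply: (@ndiff_congr _ _ _ _
   ((fun x => f x * 'D_v g x) + (fun x => g x * 'D_v f x))) => //; last first.
  by apply: ndiff_add => //; apply: IH => //; exact: ndiff_pred.
move=> x /set_mem Ux; rewrite deriveM //; apply: diff_derivable;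
  [exact: df|exact: dg].
Qed.

Lemma ndiff_prod V k (U : set V) I (r : seq I) (P : pred I) (f : I -> V -> R) :
  open U -> (forall i, P i -> ndifferentiable_on k U (f i)) ->
  ndifferentiable_on k U (fun x => \prod_(i <- r | P i) f i x).
Proof.
move=> oU df; elim: r => [|i r IH].
  rewrite (_ : (fun x => _) = cst 1) //; first exact: ndiff_cst.
  by apply/funext => x; rewrite big_nil.
rewrite (_ : (fun x => _) =
    fun x => if P i then f i x * \prod_(i <- r | P i) f i x
                    else \prod_(i <- r | P i) f i x).
  by case: (boolP (P i)) => // Pi; apply: ndiff_mul => //; exact: df.
by apply/funext => x; rewrite big_cons.
Qed.

Lemma ndiff_inv V k (U : set V) (f : V -> R) : open U ->
  (forall x, U x -> f x != 0) ->
  ndifferentiable_on k U f -> ndifferentiable_on k U (fun x => (f x)^-1).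
Proof.
move=> oU f0; elim: k => [//|k IH] /= dkf.
have [df Df] := dkf; have df' := IH (ndiff_pred dkf).
split=> [x Ux|v]; first exact: differentiableV (df x Ux) (f0 x Ux).
apply: (@ndiff_congr _ _ _ _
   (fun x => (-1) * ((f x)^-1 * (f x)^-1 * 'D_v f x))) => //; last first.
  by do !apply: ndiff_mul => //; exact: ndiff_cst.
move=> x /set_mem Ux; rewrite deriveV; [|exact: f0|exact/diff_derivable/df].
by rewrite mulN1r expr2 invfM scaleNr.
Qed.

Lemma ndiff_coord V k (U : set V) m n (f : V -> 'M[R]_(m, n)) i j : open U ->
  ndifferentiable_on k U f -> ndifferentiable_on k U (fun x => f x i j).
Proof.
move=> oU; elim: k f => [//|k IH] f /= [df Df]; split=> [x Ux|v].
  exact: (@differentiable_comp _ _ _ _ f (fun M => M i j : R) x (df x Ux)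
    (differentiable_coord _ _ _)).
apply: (@ndiff_congr _ _ _ _ (fun x => 'D_v f x i j)) (IH _ (Df v)) => //.
move=> x /set_mem Ux; rewrite derive_mx ?mxE //.
exact/diff_derivable/df.
Qed.

Lemma ndiff_row V k (U : set V) n (f : V -> 'rV[R]_n) : open U ->
  (forall j, ndifferentiable_on k U (fun x => f x 0 j)) ->
  ndifferentiable_on k U f.
Proof.
move=> oU df.
have -> : f = fun x => \sum_j f x 0 j *: delta_mx 0 j.
  by apply/funext => x; exact: row_sum_delta.
by apply: ndiff_sum => // j _; exact: ndiff_scalel.
Qed.

Lemma derive_comp_row V W n (f : V -> 'rV[R]_n) (g : 'rV[R]_n -> W) x v :
  differentiable f x -> differentiable g (f x) ->
  'D_v (g \o f) x = \sum_j 'D_v f x 0 j *: 'D_(delta_mx 0 j) g (f x).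
Proof.
move=> df dg.
have dgf := differentiable_comp df dg.
rewrite (deriveE v dgf) (diff_comp df dg) /= -(deriveE v df).
rewrite [in LHS](row_sum_delta ('D_v f x)) linear_sum.
by apply: eq_bigr => j _; rewrite linearZ /= -(deriveE _ dg).
Qed.

(** The chain rule writes a directional derivative of [g \o f] as a sum of
    products of components of derivatives of [f] with partial derivatives of [g]
    composed with [f]; the latter are covered by the induction hypothesis. *)
Lemma ndiff_comp_scalar V k (U : set V) n (U' : set 'rV[R]_n)
    (f : V -> 'rV[R]_n) (g : 'rV[R]_n -> R) :
  open U -> (forall x, U x -> U' (f x)) ->
  ndifferentiable_on k U f -> ndifferentiable_on k U' g ->
  ndifferentiable_on k U (g \o f).
Proof.
move=> oU UU'; elim: k g => [//|k IH] g dkf [dg Dg].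
have [df Df] := dkf; split=> [x Ux|v].
  exact: differentiable_comp (df x Ux) (dg _ (UU' x Ux)).
apply: (@ndiff_congr _ _ _ _
  (fun x => \sum_j 'D_v f x 0 j * 'D_(delta_mx 0 j) g (f x))) => //.
  by move=> x /set_mem Ux; rewrite derive_comp_row //; [exact: df|exact/dg/UU'].
apply: ndiff_sum => // j _; apply: ndiff_mul => //.
  exact: ndiff_coord (Df v).
exact: IH (ndiff_pred dkf) (Dg _).
Qed.

Lemma ndiff_comp V k (U : set V) m n (U' : set 'rV[R]_m)
    (f : V -> 'rV[R]_m) (g : 'rV[R]_m -> 'rV[R]_n) :
  open U -> open U' -> (forall x, U x -> U' (f x)) ->
  ndifferentiable_on k U f -> ndifferentiable_on k U' g ->
  ndifferentiable_on k U (g \o f).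
Proof.
move=> oU oU' UU' df dg; apply: ndiff_row => // j.
apply: (@ndiff_comp_scalar _ k U m U' f (fun y => g y 0 j)) => //.
exact: ndiff_coord.
Qed.

Lemma ndiff_det V k (U : set V) n (A : V -> 'M[R]_n) : open U ->
  (forall i j, ndifferentiable_on k U (fun x => A x i j)) ->
  ndifferentiable_on k U (fun x => \det (A x)).
Proof.
move=> oU dA; rewrite /determinant.
apply: (@ndiff_sum _ _ _ _ _ _ _
  (fun (s : 'S_n) x => (-1) ^+ s * \prod_i A x i (s i))) => // s _.
apply: ndiff_mul => //; first exact: ndiff_cst.
exact: (@ndiff_prod _ _ _ _ _ _ (fun i x => A x i (s i))).
Qed.

(** By Cramer's rule the entries of the inverse are cofactors divided by the
    determinant. *)
Lemma ndiff_invmx V k (U : set V) n (A : V -> 'M[R]_n) i j : open U ->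
  (forall x, U x -> A x \in unitmx) ->
  (forall i j, ndifferentiable_on k U (fun x => A x i j)) ->
  ndifferentiable_on k U (fun x => invmx (A x) i j).
Proof.
move=> oU uA dA.
apply: (@ndiff_congr _ _ _ _ (fun x => (\det (A x))^-1 *
    ((-1) ^+ (j + i) * \det (row' j (col' i (A x)))))) => //.
  by move=> x /set_mem /uA Ax; rewrite /invmx Ax !mxE.
apply: ndiff_mul => //.
  apply: ndiff_inv => //; last exact: ndiff_det.
  by move=> x /uA; rewrite unitmxE unitfE.
apply: ndiff_mul => //; first exact: ndiff_cst.
apply: ndiff_det => // a b.
by rewrite (_ : (fun x => _) = fun x => A x (lift j a) (lift i b)) //;
  apply/funext => x; rewrite !mxE.
Qed.

End Smooth.

(** * Smooth maps between manifolds and their differentials *)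

Section ManifoldCalculus.
Variable R : realType.
Implicit Types X Y Z : manifold R.

Lemma smooth_on_differentiable (V W : normedModType R) (U : set V) (f : V -> W) x :
  smooth_on U f -> U x -> differentiable f x.
Proof. by move=> /(_ 1%N) [df _]; exact: df. Qed.

Lemma open_param_preimage X (i : cindex X) (D : set X) : open D ->
  open [set x | ccod i x /\ D (param i x)].
Proof.
move=> oD; rewrite openE => x [cx Dx]; apply: filterI.
  by apply: open_nbhs_nbhs; split => //; exact: ccod_open.
by apply: (param_continuous cx); exact: open_nbhs_nbhs.
Qed.

Lemma open_preimage X (T : topologicalType) (phi : X -> T) (D : set T) :
  continuous phi -> open D -> open (phi @^-1` D).
Proof. by move=> cphi; apply: open_comp => x _; exact: cphi. Qed.

Lemma open_chart_domain X Y (phi : X -> Y) (i : cindex X) (j : cindex Y) :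
  continuous phi -> open [set x | ccod i x /\ cdom j (phi (param i x))].
Proof.
move=> cphi; apply: (@open_param_preimage _ i (phi @^-1` cdom j)).
exact: open_preimage (@cdom_open _ _ j).
Qed.

Lemma smooth_map_id X : smooth_map (@id X).
Proof. by split=> [x|i j]; [exact: cvg_id|exact: transition_smooth]. Qed.

Lemma smooth_map_comp X Y Z (phi : X -> Y) (psi : Y -> Z) :
  smooth_map phi -> smooth_map psi -> smooth_map (psi \o phi).
Proof.
move=> [cphi sphi] [cpsi spsi].
split=> [x|i k n]; first by apply: continuous_comp; [exact: cphi|exact: cpsi].
apply: ndiff_local => x [cx kx].
pose j := chart_at (phi (param i x)).
pose U : set 'rV[R]_(mdim X) := [set x | ccod i x /\
  (cdom j (phi (param i x)) /\ cdom k (psi (phi (param i x))))].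
have oU : open U.
  apply: (@open_param_preimage _ i (phi @^-1` (cdom j `&` psi @^-1` cdom k))).
  apply: open_preimage => //; apply: openI; first exact: cdom_open.
  exact: open_preimage (@cdom_open _ _ k).
(* Near [x] the local expression of [psi \o phi] factors through the chart [j]
   around [phi (param i x)]. *)
exists U; first by split=> //; split=> //; exact: chart_atP.
apply: (@ndiff_congr _ _ _ _ _
  ((chart k \o psi \o param j) \o (chart j \o phi \o param i))) => //.
  by move=> y /set_mem [_ [jy _]] /=; have [_ ->] := chartK jy.
apply: (@ndiff_comp _ _ _ _ _ _ [set y | ccod j y /\ cdom k (psi (param j y))]).
- exact: oU.
- exact: open_chart_domain.
- by move=> y [_ [jy ky]]; have [? /= ->] := chartK jy.
- apply: ndiff_sub (sphi i j n) => y [? []]; by [].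
- exact: (spsi j k n).
Qed.

Lemma smooth_fun_comp X Y (phi : X -> Y) (f : Y -> R) :
  smooth_map phi -> smooth_fun f -> smooth_fun (f \o phi).
Proof.
move=> [cphi sphi] sf i n.
apply: ndiff_local => x cx.
pose j := chart_at (phi (param i x)).
have oU := @open_chart_domain _ _ phi i j cphi.
exists [set x | ccod i x /\ cdom j (phi (param i x))].
  by split=> //; exact: chart_atP.
apply: (@ndiff_congr _ _ _ _ _
  ((f \o param j) \o (chart j \o phi \o param i))) => //.
  by move=> y /set_mem [_ jy] /=; have [_ ->] := chartK jy.
apply: (@ndiff_comp_scalar _ _ _ _ _ (ccod j)) => //.
- by move=> y [_ jy]; have [] := chartK jy.
- exact: sphi.
- exact: sf.
Qed.

Section Dmap.
Variables (X Y : manifold R) (phi : X -> Y) (p : X).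

Lemma dmapP a u v :
  dmap phi p (a *: u + v) = a *: dmap phi p u + dmap phi p v.
Proof. exact: linearP. Qed.

Lemma dmap0 : dmap phi p 0 = 0. Proof. exact: linear0. Qed.
Lemma dmapB u v : dmap phi p (u - v) = dmap phi p u - dmap phi p v.
Proof. exact: linearB. Qed.

End Dmap.

Lemma dfunP X (f : X -> R) p a u v :
  dfun f p (a *: u + v) = a * dfun f p u + dfun f p v.
Proof. exact: linearP. Qed.

Lemma chart_atK X (p : X) :
  ccod (chart_at p) (chart (chart_at p) p) /\
  param (chart_at p) (chart (chart_at p) p) = p.
Proof. exact: chartK (chart_atP p). Qed.

Lemma smooth_map_differentiable X Y (phi : X -> Y) p : smooth_map phi ->
  differentiable (chart (chart_at (phi p)) \o phi \o param (chart_at p))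
     (chart (chart_at p) p).
Proof.
move=> [_ sphi]; apply: smooth_on_differentiable (sphi _ _) _.
have [? pK] := chart_atK p.
by split=> //=; rewrite pK; exact: chart_atP.
Qed.

Lemma smooth_fun_differentiable X (f : X -> R) p : smooth_fun f ->
  differentiable (f \o param (chart_at p)) (chart (chart_at p) p).
Proof.
by move=> sf; apply: smooth_on_differentiable (sf _) _; have [] := chart_atK p.
Qed.

Lemma near_chart_domain X Y (phi : X -> Y) p : continuous phi ->
  \forall x \near chart (chart_at p) p,
    cdom (chart_at (phi p)) (phi (param (chart_at p) x)).
Proof.
move=> cphi; have [? pK] := chart_atK p.
have : nbhs (chart (chart_at p) p) [set x | ccod (chart_at p) x /\
  cdom (chart_at (phi p)) (phi (param (chart_at p) x))].
  apply: open_nbhs_nbhs; split; first exact: open_chart_domain.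
  by split=> //; rewrite pK; exact: chart_atP.
by apply: filterS => x [].
Qed.

(** The chart at [phi p] used by the two factors is the same one, and near [p] it
    cancels against its parametrisation. *)
Lemma dmap_comp X Y Z (phi : X -> Y) (psi : Y -> Z) p v :
  smooth_map phi -> smooth_map psi ->
  dmap (psi \o phi) p v = dmap psi (phi p) (dmap phi p v).
Proof.
move=> sphi spsi; have [_ pK] := chart_atK p.
have dphi := smooth_map_differentiable p sphi.
have dpsi := smooth_map_differentiable (phi p) spsi.
set x := chart _ p in dphi.
have xE : (chart (chart_at (phi p)) \o phi \o param (chart_at p)) x =
    chart (chart_at (phi p)) (phi p) by rewrite /= pK.
rewrite -xE in dpsi.
rewrite /dmap -/x -xE.
have dcomp := differentiable_comp dphi dpsi.
have E := diff_comp dphi dpsi.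
rewrite -[RHS]/(('d _ _ \o 'd _ _) v) -E.
apply: (congr1 (@^~ v)); apply: near_eq_diff dcomp.
have := near_chart_domain p (proj1 sphi).
by apply: filterS => y jy /=; have [_ ->] := chartK jy.
Qed.

Lemma dfun_comp X Y (phi : X -> Y) (f : Y -> R) p v :
  smooth_map phi -> smooth_fun f ->
  dfun (f \o phi) p v = dfun f (phi p) (dmap phi p v).
Proof.
move=> sphi sf; have [_ pK] := chart_atK p.
have dphi := smooth_map_differentiable p sphi.
have df := smooth_fun_differentiable (phi p) sf.
set x := chart _ p in dphi.
have xE : (chart (chart_at (phi p)) \o phi \o param (chart_at p)) x =
    chart (chart_at (phi p)) (phi p) by rewrite /= pK.
rewrite -xE in df.
rewrite /dfun /dmap -/x -xE.
have dcomp := differentiable_comp dphi df.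
have E := diff_comp dphi df.
rewrite -[RHS]/(('d _ _ \o 'd _ _) v) -E.
apply: (congr1 (@^~ v)); apply: near_eq_diff dcomp.
have := near_chart_domain p (proj1 sphi).
by apply: filterS => y jy /=; have [_ ->] := chartK jy.
Qed.

Lemma near_param X (i j : cindex X) p : cdom i p -> cdom j p ->
  \forall x \near chart i p, ccod i x /\ cdom j (param i x).
Proof.
move=> ip jp; have [? iK] := chartK ip; apply: open_nbhs_nbhs; split.
  by apply: (@open_param_preimage _ i (cdom j)); exact: cdom_open.
by split => //=; rewrite iK.
Qed.

Lemma transition_differentiable X (i j : cindex X) p : cdom i p -> cdom j p ->
  differentiable (chart j \o param i) (chart i p).
Proof.
move=> ip jp; apply: smooth_on_differentiable (@transition_smooth _ X i j) _.
by have [? iK] := chartK ip; split=> //=; rewrite iK.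
Qed.

(** The two transition maps between charts around [p] are inverse to each other
    near [p], hence so are their differentials. *)
Lemma diff_transitionK X (i j : cindex X) p v : cdom i p -> cdom j p ->
  'd (chart i \o param j) (chart j p) ('d (chart j \o param i) (chart i p) v) = v.
Proof.
move=> ip jp; have [_ iK] := chartK ip.
have xE : (chart j \o param i) (chart i p) = chart j p by rewrite /= iK.
have dij := transition_differentiable ip jp.
have := transition_differentiable jp ip; rewrite -xE => dji.
have E := diff_comp dij dji.
rewrite -[LHS]/(('d _ _ \o 'd _ _) v) -E.
have near_id : {near chart i p, id =1 (chart i \o param j) \o (chart j \o param i)}.
  apply: filterS (near_param ip jp) => x [cx jx] /=.
  by have [_ ->] := chartK jx; have [_ ->] := paramK cx.
have [did didE] := is_diff_id (chart i p).
by rewrite (near_eq_diff near_id did) didE.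
Qed.

Lemma dmap_id (X : manifold R) p v : dmap (@id X) p v = v.
Proof.
have [cp _] := chart_atK p.
have [did didE] := is_diff_id (chart (chart_at p) p).
have near_id : {near chart (chart_at p) p, id =1
    chart (chart_at p) \o @id X \o param (chart_at p)}.
  apply: filterS (near_param (chart_atP p) (chart_atP p)) => x [cx _] /=.
  by have [_ ->] := paramK cx.
by rewrite /dmap (near_eq_diff near_id did) didE.
Qed.

Lemma of_chartK X (i : cindex X) x v : ccod i x ->
  to_chart i (param i x) (of_chart i x v) = v.
Proof.
move=> cx; have [px xK] := paramK cx.
by have := diff_transitionK v px (chart_atP (param i x)); rewrite xK.
Qed.

Lemma to_chartK X (i : cindex X) x v : ccod i x ->
  of_chart i x (to_chart i (param i x) v) = v.
Proof.
move=> cx; have [px xK] := paramK cx.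
by have := diff_transitionK v (chart_atP (param i x)) px; rewrite xK.
Qed.

Lemma dfun_of_chart X (f : X -> R) (i : cindex X) x v : smooth_fun f ->
  ccod i x -> dfun f (param i x) (of_chart i x v) = 'd (f \o param i) x v.
Proof.
move=> sf cx; have [px xK] := paramK cx.
set a := chart_at (param i x).
have pa : cdom a (param i x) := chart_atP _.
have df := smooth_fun_differentiable (param i x) sf.
have da := transition_differentiable px pa; rewrite xK in da.
rewrite /dfun /of_chart -/a in df *.
have daE : (chart a \o param i) x = chart a (param i x) by [].
rewrite -daE in df.
have dcomp := differentiable_comp da df.
rewrite -[LHS]/(('d _ _ \o 'd _ _) v) -daE -(diff_comp da df).
apply: (congr1 (@^~ v)); apply: esym; apply: near_eq_diff dcomp.
have := near_param px pa; rewrite xK.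
by apply: filterS => y [_ jy] /=; have [_ ->] := chartK jy.
Qed.

End ManifoldCalculus.

(** * Gradients *)

Section LinearAlgebra.
Variable R : realType.

Lemma scalar_sum_delta n (g : 'rV[R]_n -> R) w :
  (forall a u v, g (a *: u + v) = a * g u + g v) ->
  g w = \sum_j w 0 j * g (delta_mx 0 j).
Proof.
move=> glin; pose gM := GRing.isLinear.Build _ _ _ _ g glin.
pose gL : {scalar 'rV[R]_n} := HB.pack g gM.
rewrite -[LHS]/(gL w) {1}(row_sum_delta w) linear_sum.
by apply: eq_bigr => j _; rewrite linearZ.
Qed.

Lemma linear_inj_surj n (f : 'rV[R]_n -> 'rV[R]_n) : linear f ->
  (forall v, f v = 0 -> v = 0) -> forall w, exists v, f v = w.
Proof.
move=> flin f0 w; pose fM := GRing.isLinear.Build _ _ _ _ f flin.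
pose fL : {linear 'rV[R]_n -> 'rV[R]_n} := HB.pack f fM.
have fE v : v *m lin1_mx fL = f v by rewrite mul_rV_lin1.
have fU : lin1_mx fL \in unitmx.
  by rewrite -row_free_unit; apply: inj_row_free => v; rewrite fE; exact: f0.
by exists (w *m invmx (lin1_mx fL)); rewrite -fE mulmxKV.
Qed.

End LinearAlgebra.

Section Metrics.
Variable R : realType.
Implicit Types X Y : manifold R.

Section OneMetric.
Variables (X : manifold R) (eta : metric_tensor X).
Hypothesis eta_metric : riemannian_metric eta.

Lemma metric_linl p a u v w : eta p (a *: u + v) w = a * eta p u w + eta p v w.
Proof. by have [] := eta_metric. Qed.

Lemma metric_sym p v w : eta p v w = eta p w v.
Proof. by have [] := eta_metric. Qed.

Lemma metric_linr p a u v w : eta p w (a *: u + v) = a * eta p w u + eta p w v.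
Proof. by rewrite metric_sym metric_linl !(metric_sym p _ w). Qed.

Lemma metric0l p w : eta p 0 w = 0.
Proof.
by have := metric_linl p (-1) 0 0 w; rewrite scaler0 addr0 mulN1r addNr.
Qed.

Lemma metric_eq0 p v : eta p v v = 0 -> v = 0.
Proof.
have [_ _ pos _] := eta_metric; move=> v0; apply/eqP/negPn/negP => /(pos p).
by rewrite v0 ltxx.
Qed.

Lemma metric_inj p u v : (forall w, eta p u w = eta p v w) -> u = v.
Proof.
move=> uv; apply/eqP; rewrite -subr_eq0; apply/eqP.
apply: (@metric_eq0 p); rewrite -[u - v]addrC -scaleN1r metric_linl uv.
by rewrite mulN1r addNr.
Qed.

(** Positive definiteness makes the linear map sending [v] to the coefficients of
    [eta p v] injective, hence surjective; so the set in the definition of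
    [sharp] is inhabited and its default value [0] is never used. *)
Lemma sharpP p (alpha : tangent X -> R) :
  (forall a u v, alpha (a *: u + v) = a * alpha u + alpha v) ->
  forall w, eta p (sharp eta p alpha) w = alpha w.
Proof.
move=> alin; have [v vE] : exists v, forall w, eta p v w = alpha w.
  pose flat v : 'rV[R]_(mdim X) := \row_j eta p v (delta_mx 0 j).
  have metricE v w : eta p v w = \sum_j w 0 j * flat v 0 j.
    rewrite (scalar_sum_delta w (fun a u u' => metric_linr p a u u' v)).
    by apply: eq_bigr => j _; rewrite mxE.
  have flat_lin : linear flat.
    by move=> a u v; apply/rowP => j; rewrite !mxE metric_linl.
  have flat_inj v : flat v = 0 -> v = 0.
    move=> v0; apply: (@metric_eq0 p); rewrite metricE v0 big1 // => j _.
    by rewrite mxE mulr0.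
  have [v vE] := linear_inj_surj flat_lin flat_inj (\row_j alpha (delta_mx 0 j)).
  exists v => w; rewrite metricE vE (scalar_sum_delta w alin).
  by apply: eq_bigr => j _; rewrite mxE.
exact: (@xgetPex _ 0 [set v | forall w, eta p v w = alpha w] (ex_intro _ v vE)).
Qed.

Lemma sharp_eq p (alpha : tangent X -> R) v :
  (forall w, eta p v w = alpha w) -> sharp eta p alpha = v.
Proof.
move=> vE; apply: (@metric_inj p) => w; rewrite vE; apply: sharpP => a u u'.
by rewrite -!vE metric_linr.
Qed.

Lemma gradP f p w : eta p (grad eta f p) w = dfun f p w.
Proof. by apply: sharpP => a u v; exact: dfunP. Qed.

(** Pairing the gradient with the coordinate fields of a chart shows that its
    components times the Gram matrix give the partial derivatives of [f]. *)
Lemma grad_vector_field f : smooth_fun f -> vector_field (grad eta f).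
Proof.
move=> sf i n; have oU := @ccod_open _ _ i.
pose e a : tangent X := delta_mx 0 a.
pose gram x := \matrix_(a, b) eta (param i x) (of_chart i x (e a)) (of_chart i x (e b)).
pose df x := \row_a 'D_(e a) (f \o param i) x.
have of_chart_lin x a u v :
    of_chart i x (a *: u + v) = a *: of_chart i x u + of_chart i x v.
  exact: linearP.
have gramE x v b :
    (v *m gram x) 0 b = eta (param i x) (of_chart i x v) (of_chart i x (e b)).
  rewrite (@scalar_sum_delta _ _ (fun v => eta (param i x) (of_chart i x v)
    (of_chart i x (e b))) v); last first.
    by move=> a u u'; rewrite of_chart_lin metric_linl.
  by rewrite mxE; apply: eq_bigr => a _; rewrite mxE.
have gramU x : ccod i x -> gram x \in unitmx.
  move=> cx; rewrite -row_free_unit; apply: inj_row_free => v v0.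
  have ofv0 : of_chart i x v = 0.
    apply: (@metric_eq0 (param i x)).
    rewrite (@scalar_sum_delta _ _ (fun w => eta (param i x) (of_chart i x v)
      (of_chart i x w)) v); last first.
      by move=> a u u'; rewrite of_chart_lin metric_linr.
    by rewrite big1 // => b _; rewrite -gramE v0 mxE mulr0.
  by rewrite -[v](of_chartK v cx) ofv0; exact: linear0.
apply: (@ndiff_congr _ _ _ _ _ (fun x => df x *m invmx (gram x))) => //.
  move=> x /set_mem cx.
  apply/esym/(canRL (mulmxK (gramU x cx))); apply/rowP => b.
  rewrite gramE to_chartK // gradP dfun_of_chart // mxE.
  by rewrite -deriveE //; exact: smooth_on_differentiable (sf i) cx.
apply: ndiff_row => // j.
rewrite (_ : (fun x => _) =
  fun x => \sum_a 'D_(e a) (f \o param i) x * invmx (gram x) a j); last first.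
  by apply/funext => x; rewrite mxE; apply: eq_bigr => a _; rewrite mxE.
apply: ndiff_sum => // a _; apply: ndiff_mul => //.
  exact: (proj2 (sf i n.+1)).
apply: ndiff_invmx => // b c.
rewrite (_ : (fun x => _) = fun x =>
  eta (param i x) (of_chart i x (e b)) (of_chart i x (e c))).
  by have [_ _ _ sm] := eta_metric; exact: sm.
by apply/funext => x; rewrite mxE.
Qed.

End OneMetric.

Section PushForward.
Variables (X Y : manifold R) (phi : X -> Y).
Variables (etaX : metric_tensor X) (etaY : metric_tensor Y) (e : X).
Hypotheses (metricX : riemannian_metric etaX) (metricY : riemannian_metric etaY).
Hypothesis dmap_surj : forall w, exists v, dmap phi e v = w.

Lemma codiffP (beta : tangent Y -> R) :
  (forall a u v, beta (a *: u + v) = a * beta u + beta v) ->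
  forall v, etaX e (sharp etaX e (codiff phi e beta)) v = beta (dmap phi e v).
Proof.
by move=> blin v; rewrite sharpP // => a u u'; rewrite /codiff /= dmapP blin.
Qed.

Lemma horizontal_sharp (beta : tangent Y -> R) :
  (forall a u v, beta (a *: u + v) = a * beta u + beta v) ->
  horizontal phi etaX e (sharp etaX e (codiff phi e beta)).
Proof.
move=> blin u u0; rewrite codiffP // u0.
have := blin (-1) 0 0; rewrite scaler0 addr0 mulN1r addNr; exact.
Qed.

(** The vectors representing pulled back covectors are horizontal. Sending [u] to
    the image under [dmap phi e] of the vector representing the pullback of the
    covector dual to [u] is a linear endomorphism of the tangent space of [Y];
    it is injective because [etaY u (T u)] is the squared norm of that vector. *)
Lemma horizontal_lift w : exists2 v, horizontal phi etaX e v & dmap phi e v = w.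
Proof.
pose lift u := sharp etaX e (codiff phi e (etaY (phi e) u)).
have liftP u v : etaX e (lift u) v = etaY (phi e) u (dmap phi e v).
  by apply: codiffP => a v1 v2; rewrite metric_linr.
pose T u := dmap phi e (lift u).
have Tlin : linear T.
  move=> a u v; rewrite /T -dmapP; congr (dmap phi e _).
  apply: (metric_inj metricX (p := e)) => z.
  by rewrite (metric_linl metricX) !liftP (metric_linl metricY).
have Tinj u : T u = 0 -> u = 0.
  move=> u0; apply: (metric_eq0 metricY (p := phi e)).
  have l0 : lift u = 0.
    apply: (metric_eq0 metricX (p := e)).
    by rewrite liftP -/(T u) u0 (metric_sym metricY) (metric0l metricY).
  have [v {2}<-] := dmap_surj u.
  by rewrite -liftP l0 (metric0l metricX).
have [u <-] := linear_inj_surj Tlin Tinj w.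
by exists (lift u) => //; apply: horizontal_sharp => a v1 v2; rewrite metric_linr.
Qed.

Hypothesis isometric : forall v w,
  horizontal phi etaX e v -> horizontal phi etaX e w ->
  etaY (phi e) (dmap phi e v) (dmap phi e w) = etaX e v w.

(** The gradient of [f \o phi] is orthogonal to the kernel of the differential of
    [phi], on which [f \o phi] does not vary. Hence its image can be tested
    against images of horizontal vectors, where [phi] is isometric. *)
Lemma grad_pushforward f : smooth_map phi -> smooth_fun f ->
  dmap phi e (grad etaX (f \o phi) e) = grad etaY f (phi e).
Proof.
move=> sphi sf; apply/esym/(sharp_eq metricY) => w.
have [v hv <-] := horizontal_lift w.
have gradE u : etaX e (grad etaX (f \o phi) e) u = dfun f (phi e) (dmap phi e u).
  by rewrite (gradP metricX) (dfun_comp e u sphi sf).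
have hg : horizontal phi etaX e (grad etaX (f \o phi) e).
  by move=> u u0; rewrite gradE u0; exact: linear0.
by rewrite (isometric hg hv) gradE.
Qed.

End PushForward.

Lemma riemannian_submersion_grad X Y (phi : X -> Y) etaX etaY f e :
  riemannian_metric etaX -> pushforward_metric phi etaX etaY -> smooth_fun f ->
  dmap phi e (grad etaX (f \o phi) e) = grad etaY f (phi e).
Proof.
move=> mX [mY [[sphi _ dphi] iso]] sf.
exact: (grad_pushforward mX mY (dphi e) (iso e) sphi sf).
Qed.

(** A map preserving the metric has injective differentials between spaces of the
    same dimension, so they are bijective and every vector is horizontal. *)
Lemma isometry_grad X (phi : X -> X) eta f e :
  riemannian_metric eta -> smooth_map phi -> preserves_metric phi eta ->
  smooth_fun f ->
  dmap phi e (grad eta (f \o phi) e) = grad eta f (phi e).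
Proof.
move=> mX sphi iso sf.
apply: (grad_pushforward mX mX) sphi sf => [w|v w _ _]; last exact: iso.
apply: linear_inj_surj w; first by move=> a u v; exact: dmapP.
move=> v v0; apply: (metric_eq0 mX (p := e)).
by rewrite -iso v0 (metric0l mX).
Qed.

End Metrics.

(** * Composable pairs and the symmetries of triangles *)

Section Groupoids.
Variables (R : realType) (G : lie_groupoid R).
Implicit Types (p q r : gpairs G) (g h : garr G).

Local Notation fst := (@fp1 _ _ _ _ _ _ (gpairs G)).
Local Notation snd := (@fp2 _ _ _ _ _ _ (gpairs G)).
Local Notation mul := (@gmul _ G).

Lemma fp_pairE p g h (e : gsrc g = gtgt h) :
  fst p = g -> snd p = h -> fp_pair (gpairs G) e = p.
Proof. by move=> pg ph; apply: fp_inj; rewrite ?fp1_pair ?fp2_pair. Qed.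

(** Associativity for arbitrary points of [gpairs G] instead of the dependent
    pairs [fp_pair]: with [p = (g, h)] and [q = (h, k)], the points [r] and [s]
    are [(g, hk)] and [(gh, k)]. The next four lemmas have the same form. *)
Lemma gmul_assoc p q r s : fst q = snd p -> fst r = fst p -> snd r = mul q ->
  fst s = mul p -> snd s = snd q -> mul r = mul s.
Proof.
move=> qp rp rq sp sq.
have pq : gsrc (fst p) = gtgt (snd p) := fp_comm p.
have hk : gsrc (snd p) = gtgt (snd q) by rewrite -qp (fp_comm q).
have qE : fp_pair (gpairs G) hk = q by exact: fp_pairE.
have pE : fp_pair (gpairs G) pq = p by exact: fp_pairE.
have g_hk : gsrc (fst p) = gtgt (mul (fp_pair (gpairs G) hk)).
  by rewrite qE -rp -rq (fp_comm r).
have gh_k : gsrc (mul (fp_pair (gpairs G) pq)) = gtgt (snd q).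
  by rewrite pE -sp -sq (fp_comm s).
have := gmulA g_hk gh_k.
by rewrite (fp_pairE (p := r)) ?qE // (fp_pairE (p := s)) ?pE.
Qed.

Lemma gmul_unitr p : snd p = gunit (gsrc (fst p)) -> mul p = fst p.
Proof.
move=> pu; have e : gsrc (fst p) = gtgt (gunit (gsrc (fst p))).
  by rewrite gtgt_unit.
by rewrite -[RHS](gmul1 e) (fp_pairE (p := p)).
Qed.

Lemma gmul_unitl p : fst p = gunit (gtgt (snd p)) -> mul p = snd p.
Proof.
move=> pu; have e : gsrc (gunit (gtgt (snd p))) = gtgt (snd p).
  by rewrite gsrc_unit.
by rewrite -[RHS](gmul1l e) (fp_pairE (p := p)).
Qed.

Lemma gmul_divr p q : fst q = mul p -> snd q = ginv (snd p) -> mul q = fst p.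
Proof.
move=> qp qv.
have er : gsrc (snd p) = gtgt (ginv (snd p)) by rewrite gtgt_inv.
pose r := fp_pair (gpairs G) er.
have rE : mul r = gunit (gsrc (fst p)) by rewrite /r gmulV (fp_comm p).
have es : gsrc (fst p) = gtgt (mul r) by rewrite rE gtgt_unit.
pose s := fp_pair (gpairs G) es.
have <- : mul s = mul q.
  by apply: (@gmul_assoc p r); rewrite ?fp1_pair ?fp2_pair.
have s1 : fst s = fst p by rewrite fp1_pair.
rewrite -[RHS]s1.
by apply: gmul_unitr; rewrite fp1_pair fp2_pair.
Qed.

Lemma gmul_divl p q : fst q = ginv (fst p) -> snd q = mul p -> mul q = snd p.
Proof.
move=> qv qp.
have er : gsrc (ginv (fst p)) = gtgt (fst p) by rewrite gsrc_inv.
pose r := fp_pair (gpairs G) er.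
have rE : mul r = gunit (gtgt (snd p)) by rewrite /r gmulVl (fp_comm p).
have es : gsrc (mul r) = gtgt (snd p) by rewrite rE gsrc_unit.
pose s := fp_pair (gpairs G) es.
have -> : mul q = mul s.
  by apply: (@gmul_assoc r p); rewrite ?fp1_pair ?fp2_pair.
have s2 : snd s = snd p by rewrite fp2_pair.
rewrite -[RHS]s2.
by apply: gmul_unitl; rewrite fp1_pair fp2_pair.
Qed.

(** On pairs, [swap12] is [(g, h) |-> (gh, h^-1)] and [swap01] is
    [(g, h) |-> (g^-1, gh)]; they exchange the vertices [1], [2] and [0], [1]. *)
Definition swap12 : gpairs G -> gpairs G :=
  triangle_act (tperm (inord 1) (inord 2)).
Definition swap01 : gpairs G -> gpairs G :=
  triangle_act (tperm (inord 0) (inord 1)).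

Lemma ord3_neq : ((inord 0 : 'I_3) != inord 1) * ((inord 0 : 'I_3) != inord 2) *
  ((inord 1 : 'I_3) != inord 2).
Proof. by do !split; rewrite -val_eqE /= !inordK. Qed.

Lemma swap12E p : (fst (swap12 p) = mul p) * (snd (swap12 p) = ginv (snd p)).
Proof.
rewrite /swap12 /triangle_act fp1_pair fp2_pair tpermL tpermR.
rewrite tpermD 1?eq_sym ?ord3_neq // /edge /= !inordK //.
Qed.

Lemma swap01E p : (fst (swap01 p) = ginv (fst p)) * (snd (swap01 p) = mul p).
Proof.
rewrite /swap01 /triangle_act fp1_pair fp2_pair tpermL tpermR.
rewrite tpermD ?ord3_neq // /edge /= !inordK //.
Qed.

Lemma gmul_swap12 : mul \o swap12 = fst.
Proof. by apply/funext => p /=; apply: gmul_divr; rewrite swap12E. Qed.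

Lemma gmul_swap01 : mul \o swap01 = snd.
Proof. by apply/funext => p /=; apply: gmul_divl; rewrite swap01E. Qed.

Lemma smooth_swap12 : smooth_map swap12.
Proof.
apply: fp_universal.
  rewrite (_ : _ \o _ = mul); first exact: gmul_smooth.
  by apply/funext => p /=; rewrite swap12E.
rewrite (_ : _ \o _ = @ginv _ G \o snd).
  exact: smooth_map_comp (@fp2_smooth _ _ _ _ _ _ (gpairs G)) (@ginv_smooth _ G).
by apply/funext => p /=; rewrite swap12E.
Qed.

Lemma smooth_swap01 : smooth_map swap01.
Proof.
apply: fp_universal.
  rewrite (_ : _ \o _ = @ginv _ G \o fst).
    exact: smooth_map_comp (@fp1_smooth _ _ _ _ _ _ (gpairs G)) (@ginv_smooth _ G).
  by apply/funext => p /=; rewrite swap01E.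
rewrite (_ : _ \o _ = mul); first exact: gmul_smooth.
by apply/funext => p /=; rewrite swap01E.
Qed.

(** The smooth sections [h |-> (1, h)] and [g |-> (g, 1)] of the multiplication;
    differentiating them gives the unit laws of the tangent groupoid. *)
Definition unit_left h : gpairs G := fp_pair (gpairs G) (gsrc_unit (gtgt h)).
Definition unit_right g : gpairs G :=
  fp_pair (gpairs G) (esym (gtgt_unit (gsrc g))).

Lemma fst_unit_left : fst \o unit_left = @gunit _ G \o @gtgt _ G.
Proof. by apply/funext => h /=; rewrite fp1_pair. Qed.
Lemma snd_unit_left : snd \o unit_left = id.
Proof. by apply/funext => h /=; rewrite fp2_pair. Qed.
Lemma gmul_unit_left : mul \o unit_left = id.
Proof. by apply/funext => h /=; exact: gmul1l. Qed.

Lemma fst_unit_right : fst \o unit_right = id.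
Proof. by apply/funext => h /=; rewrite fp1_pair. Qed.
Lemma snd_unit_right : snd \o unit_right = @gunit _ G \o @gsrc _ G.
Proof. by apply/funext => h /=; rewrite fp2_pair. Qed.
Lemma gmul_unit_right : mul \o unit_right = id.
Proof. by apply/funext => h /=; exact: gmul1. Qed.

(** * Idempotents in the tangent groupoid *)

Lemma smooth_gsrc : smooth_map (@gsrc _ G).
Proof. by have [] := gsrc_submersion G. Qed.
Lemma smooth_gtgt : smooth_map (@gtgt _ G).
Proof. by have [] := gtgt_submersion G. Qed.

Lemma smooth_unit_left : smooth_map unit_left.
Proof.
apply: fp_universal.
  rewrite fst_unit_left; exact: smooth_map_comp smooth_gtgt (@gunit_smooth _ G).
by rewrite snd_unit_left; exact: smooth_map_id.
Qed.

Lemma smooth_unit_right : smooth_map unit_right.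
Proof.
apply: fp_universal.
  by rewrite fst_unit_right; exact: smooth_map_id.
rewrite snd_unit_right; exact: smooth_map_comp smooth_gsrc (@gunit_smooth _ G).
Qed.

Lemma dmap_gsrc_gunit x v :
  dmap (@gsrc _ G) (gunit x) (dmap (@gunit _ G) x v) = v.
Proof.
rewrite -(dmap_comp x v (@gunit_smooth _ G) smooth_gsrc).
rewrite (_ : _ \o _ = @id (gobj G)) ?dmap_id //.
by apply/funext => y /=; rewrite gsrc_unit.
Qed.

(** Above a unit the pair [(xi, 0)] is the image of [xi] under the differential of
    [unit_right], a section of the multiplication. *)
Lemma dmap_gmul_0r p x xi (z : tangent (gpairs G)) :
  fst p = gunit x -> snd p = gunit x ->
  dmap fst p z = xi -> dmap snd p z = 0 -> dmap (@gsrc _ G) (gunit x) xi = 0 ->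
  dmap mul p z = xi.
Proof.
move=> p1 p2 z1 z2 sxi.
have pE : unit_right (gunit x) = p.
  by apply: fp_pairE; rewrite ?p1 ?p2 ?gsrc_unit.
pose b := dmap unit_right (gunit x) xi.
have b1 : dmap fst p b = xi.
  rewrite -pE -(dmap_comp _ _ smooth_unit_right (@fp1_smooth _ _ _ _ _ _ (gpairs G))).
  by rewrite fst_unit_right dmap_id.
have b2 : dmap snd p b = 0.
  rewrite -pE -(dmap_comp _ _ smooth_unit_right (@fp2_smooth _ _ _ _ _ _ (gpairs G))).
  rewrite snd_unit_right (dmap_comp _ _ smooth_gsrc (@gunit_smooth _ G)).
  by rewrite sxi dmap0.
have [| y [_ yU]] := @fp_tangent _ _ _ _ _ _ (gpairs G) p xi 0.
  by rewrite p1 sxi dmap0.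
have -> : z = b by rewrite -(yU z (conj z1 z2)) -(yU b (conj b1 b2)).
rewrite -pE -(dmap_comp _ _ smooth_unit_right (@gmul_smooth _ G)).
by rewrite gmul_unit_right dmap_id.
Qed.

(** Let [W] be the unit over [X0]. Both [(V, V)] and [(W, V)] multiply to [V], so
    their difference [(V - W, 0)] multiplies to [0]; but it also multiplies to
    [V - W]. *)
Lemma idempotent_tangent_unit p x (X0 : tangent (gobj G)) (V : tangent (garr G))
    (z : tangent (gpairs G)) :
  fst p = gunit x -> snd p = gunit x ->
  dmap (@gsrc _ G) (gunit x) V = X0 -> dmap (@gtgt _ G) (gunit x) V = X0 ->
  dmap fst p z = V -> dmap snd p z = V -> dmap mul p z = V ->
  dmap (@gunit _ G) x X0 = V.
Proof.
move=> p1 p2 sV tV z1 z2 zm.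
have pE : unit_left (gunit x) = p.
  by apply: fp_pairE; rewrite ?p1 ?p2 ?gtgt_unit.
pose a := dmap unit_left (gunit x) V.
have a1 : dmap fst p a = dmap (@gunit _ G) x X0.
  rewrite -pE -(dmap_comp _ _ smooth_unit_left (@fp1_smooth _ _ _ _ _ _ (gpairs G))).
  rewrite fst_unit_left (dmap_comp _ _ smooth_gtgt (@gunit_smooth _ G)).
  by rewrite tV gtgt_unit.
have a2 : dmap snd p a = V.
  rewrite -pE -(dmap_comp _ _ smooth_unit_left (@fp2_smooth _ _ _ _ _ _ (gpairs G))).
  by rewrite snd_unit_left dmap_id.
have am : dmap mul p a = V.
  rewrite -pE -(dmap_comp _ _ smooth_unit_left (@gmul_smooth _ G)).
  by rewrite gmul_unit_left dmap_id.
apply/esym/subr0_eq; rewrite -[LHS](@dmap_gmul_0r p x _ (z - a)) //.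
- by rewrite dmapB zm am subrr.
- by rewrite dmapB z1 a1.
- by rewrite dmapB z2 a2 subrr.
- by rewrite dmapB sV dmap_gsrc_gunit subrr.
Qed.

End Groupoids.

(** * The gradient of a basic function is multiplicative *)

Section TwoMetrics.
Variables (R : realType) (G : lie_groupoid R).
Variables (eta2 : metric_tensor (gpairs G)) (eta1 : metric_tensor (garr G)).
Hypothesis metric2 : riemannian_metric eta2.
Hypothesis push1 : pushforward_metric (@gmul _ G) eta2 eta1.
Variable (F : garr G -> R).
Hypothesis smoothF : smooth_fun F.

(** [T] preserves the gradient of [F \o gmul], since it preserves the metric and
    the function; [gmul] then maps this gradient to that of [F]. *)
Lemma grad_gmul_isometry (T : gpairs G -> gpairs G) (psi : gpairs G -> garr G) p :
  smooth_map T -> preserves_metric T eta2 -> @gmul _ G \o T = psi ->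
  F \o @gmul _ G = F \o psi ->
  dmap psi p (grad eta2 (F \o @gmul _ G) p) = grad eta1 F (psi p).
Proof.
move=> sT isoT <- FT.
have sFm := smooth_fun_comp (@gmul_smooth _ G) smoothF.
rewrite (dmap_comp _ _ sT (@gmul_smooth _ G)) FT.
rewrite [X in dmap _ _ X](isometry_grad p metric2 sT isoT sFm).
exact: riemannian_submersion_grad.
Qed.

End TwoMetrics.

Theorem proposition6p3 (R : realType) (G : lie_groupoid R)
    (eta2 : metric_tensor (gpairs G))
    (eta1 : metric_tensor (garr G)) (eta0 : metric_tensor (gobj G))
    (eta2_two_metric : two_metric eta2)
    (eta10_induced : induced_metrics eta2 eta1 eta0)
    (F : garr G -> R) (f : gobj G -> R)
    (f_basic : basic_function f)
    (F_morphism : real_lie_morphism F f) :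
  multiplicative_vector_field (grad eta1 (f \o @gsrc R G)) (grad eta0 f).
Proof.
have [metric2 isom _] := eta2_two_metric.
have [push1 push0] := eta10_induced.
have [metric1 _] := push1; have [metric0 _] := push0.
have [sf f_st] := f_basic.
have ssf : smooth_fun (f \o @gsrc R G).
  exact: smooth_fun_comp (smooth_gsrc G) sf.
pose V := grad eta1 (f \o @gsrc R G).
pose Z := grad eta2 (f \o @gsrc R G \o @gmul R G).
have Zm p : dmap (@gmul R G) p (Z p) = V (gmul p).
  exact: riemannian_submersion_grad metric2 push1 ssf.
have f_fst : f \o @gsrc R G \o @gmul R G =
    f \o @gsrc R G \o @fp1 _ _ _ _ _ _ (gpairs G).
  apply/funext => p; rewrite /= [LHS](congr1 (@^~ _) f_st) /= gtgt_mul.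
  by rewrite -[LHS]/((f \o @gtgt R G) _) -f_st.
have f_snd : f \o @gsrc R G \o @gmul R G =
    f \o @gsrc R G \o @fp2 _ _ _ _ _ _ (gpairs G).
  by apply/funext => p; rewrite /= gsrc_mul.
have Z1 p : dmap (@fp1 _ _ _ _ _ _ (gpairs G)) p (Z p) = V (fp1 p).
  exact (grad_gmul_isometry metric2 push1 ssf p (@smooth_swap12 _ G) (isom _)
    (@gmul_swap12 _ G) f_fst).
have Z2 p : dmap (@fp2 _ _ _ _ _ _ (gpairs G)) p (Z p) = V (fp2 p).
  exact (grad_gmul_isometry metric2 push1 ssf p (@smooth_swap01 _ G) (isom _)
    (@gmul_swap01 _ G) f_snd).
have sV g : dmap (@gsrc R G) g (V g) = grad eta0 f (gsrc g).
  exact: riemannian_submersion_grad metric1 push0 sf.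
have tV g : dmap (@gtgt R G) g (V g) = grad eta0 f (gtgt g).
  (* Any pair with second entry [g] does; [V] at its first entry has source
     projection [grad eta0 f (gtgt g)]. *)
  pose p := unit_left g.
  have p2 : fp2 p = g by rewrite /p /unit_left fp2_pair.
  rewrite -p2 -Z2 -(dmap_comp _ _ (@fp2_smooth _ _ _ _ _ _ (gpairs G)) (smooth_gtgt G)).
  rewrite (_ : _ \o _ = @gsrc R G \o @fp1 _ _ _ _ _ _ (gpairs G)); last first.
    by apply/funext => q /=; rewrite (fp_comm q).
  rewrite (dmap_comp _ _ (@fp1_smooth _ _ _ _ _ _ (gpairs G)) (smooth_gsrc G)).
  by rewrite Z1 sV (fp_comm p).
split; [exact: grad_vector_field|exact: grad_vector_field|].
split=> [g|g|x|g h k [p [<- <- <-]]].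
- by rewrite /= /tmap /= sV.
- by rewrite /= /tmap /= tV.
- rewrite /= /tmap /=; congr (_, _).
  pose p := unit_left (gunit x).
  have p1 : fp1 p = gunit x by rewrite /p /unit_left fp1_pair gtgt_unit.
  have p2 : fp2 p = gunit x by rewrite /p /unit_left fp2_pair.
  have pm : gmul p = gunit x.
    by rewrite gmul_unitl // p1 p2 gtgt_unit.
  have sx : dmap (@gsrc R G) (gunit x) (V (gunit x)) = grad eta0 f x.
    by rewrite sV gsrc_unit.
  have tx : dmap (@gtgt R G) (gunit x) (V (gunit x)) = grad eta0 f x.
    by rewrite tV gtgt_unit.
  have z1 := Z1 p; have z2 := Z2 p; have zm := Zm p.
  rewrite p1 in z1; rewrite p2 in z2; rewrite pm in zm.
  exact (esym (idempotent_tangent_unit p1 p2 sx tx z1 z2 zm)).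
- exists (p, Z p); rewrite /tmap /=; split; congr (_, _).
  + exact: Z1.
  + exact: Z2.
  + exact: Zm.
Qed.
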